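(* Let $n\ge1$, $e\ge 0$ and $t>1$ be integers, $q=(2e+1)t$, and suppose that $(e,q)$ is an $n$-maximal pair. Then the map $$\psi:\nabla_n(2e+1)_{\mathrm{red}}\to LPL^{\infty}(n,e,q)_o,\qquad \psi(M)=\mathrm{span}(M)/q\mathbb{Z}^n,$$ is a parametrization (i.e. a well-defined bijection).
   Context: For $a\in\mathbb{Z}_q$ with representative $\tilde a\in\{0,\dots,q-1\}$ put $|a|_1=\min\{\tilde a,q-\tilde a\}$. The maximum metric on $\mathbb{Z}_q^n$ is $d(x,y)=\max_i|x_i-y_i|_1$, and $B(x,r)=\{y\in\mathbb{Z}_q^n: d(x,y)\le r\}$. $LPL^{\infty}(n,e,q)$ is the set of linear perfect codes with packing radius $e$, i.e. of subgroups $C$ of $(\mathbb{Z}_q^n,+)$ with $\#C>1$ such that $\mathbb{Z}_q^n$ is the disjoint union of the balls $B(c,e)$, $c\in C$. Sections: for $I\subseteq[n]=\{1,\dots,n\}$ let $H_I=\{x\in\mathbb{Z}_q^n:x_i=0\ \forall i\in I\}$, let $\pi_I:\mathbb{Z}_q^n\to\mathbb{Z}_q^n$ be the homomorphism that sets the coordinates in $I$ to $0$ and keeps the others, $B(H_I,e)=\bigcup_{h\in H_I}B(h,e)$, and $C\langle I\rangle=\pi_I(B(H_I,e)\cap C)$. Ordered codes: a code $D\subseteq\mathbb{Z}_q^n$ is of type $i$ if $D+(2e+1)e_i\subseteq D$ ($e_i$ the $i$-th canonical vector), and $\tau(D)=\max\{i: D\text{ is of type }i\}$. For $C\in LPL^{\infty}(n,e,q)$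 define $\wp_1=\tau(C)$, $J_1=\{\wp_1\}$, $C_1=C\langle J_1\rangle$, and for $1\le i<n$, $\wp_{i+1}=\tau(C_i)$, $J_{i+1}=J_i\cup\{\wp_{i+1}\}$, $C_{i+1}=C\langle J_{i+1}\rangle$. (By the Minkowski–Hajós theorem these are well defined and $(\wp_1,\dots,\wp_n)$ is a permutation of $[n]$.) $C$ is ordered if $(\wp_1,\dots,\wp_n)=(n,n-1,\dots,2,1)$. $LPL^{\infty}(n,e,q)_o$ is the set of ordered codes in $LPL^{\infty}(n,e,q)$. Maximality: the pair $(e,q)$ is $n$-maximal if $\#LPL^{\infty}(n,e,q)_o=(2e+1)^{\binom n2}$ (which is the largest possible value). Matrices: $\nabla_n(2e+1)$ is the set of upper triangular $n\times n$ integer matrices with all diagonal entries equal to $2e+1$; $\nabla_n(2e+1)_{\mathrm{red}}$ is its subset of reduced matrices, i.e. those with $|M_{ij}|\le e$ for $1\le i<j\le n$. $\mathrm{span}(M)\subseteq\mathbb{Z}^n$ is the subgroup generated by the rows of $M$, and $\mathrm{span}(M)/q\mathbb{Z}^n$ is viewed as a subgroup of $\mathbb{Z}_q^n$. *)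

(* Defs.v *)
From mathcomp Require Import all_boot all_order all_algebra all_fingroup.
From mathcomp Require Import boolp classical_sets functions.

Set Implicit Arguments.
Unset Strict Implicit.
Unset Printing Implicit Defensive.

Import Order.TTheory GRing.Theory Num.Theory.
Local Open Scope ring_scope.

(* 'Z_q is the ring of integers modulo q only for q >= 2. *)
Notation Zqn q n := 'rV['Z_q]_n.

Section MaximumMetric.

Variables q n : nat.
Implicit Types (x y : Zqn q n) (C D : {set Zqn q n}) (I : {set 'I_n}).

Definition labs (a : 'Z_q) : nat := minn a (q - a).

Definition dmax x y : nat := \max_(i < n) labs (x 0 i - y 0 i)%R.

Definition ball x (r : nat) : {set Zqn q n} := [set y | dmax x y <= r]%N.

(* The disjointness of balls is indexed by the codewords, so that two distinct
   codewords with the same ball are excluded. *)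
Definition perfect e C : bool :=
  (\bigcup_(c in C) ball c e == [set: Zqn q n]) &&
  [forall c in C, forall c' in C,
     (c != c') ==> [disjoint ball c e & ball c' e]].

(* The group law of the finGroupType on Zqn q n is the addition, hence
   group_set C says that C is an additive subgroup. *)
Definition LPL e : {set {set Zqn q n}} :=
  [set C : {set Zqn q n} | [&& group_set C, 1 < #|C| & perfect e C]]%N.

Definition coordH I : {set Zqn q n} :=
  [set x : Zqn q n | [forall i in I, x 0 i == 0]].

Definition proj I x : Zqn q n := \row_i (if i \in I then 0 else x 0 i).

Definition csection e C I : {set Zqn q n} :=
  [set proj I x | x in (\bigcup_(h in coordH I) ball h e) :&: C].

Definition of_type e D (i : 'I_n) : bool :=
  [forall x in D, x + delta_mx 0 i *+ (2 * e + 1) \in D].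

(* Coordinates are numbered from 1: the ordinal i stands for the coordinate
   i.+1. The value 0 means that D is of no type. *)
Definition tau e D : nat := \max_(i < n | of_type e D i) i.+1.

(* The pair (J_k, C_k), starting from J_0 = set0 and C_0 = C. *)
Fixpoint JC e C (k : nat) : {set 'I_n} * {set Zqn q n} :=
  if k is k'.+1 then
    let J := (JC e C k').1 :|: [set j : 'I_n | j.+1 == tau e (JC e C k').2] in
    (J, csection e C J)
  else (finset.set0, C).

(* wp e C k = tau(C_k) is the term wp_{k+1} of (wp_1, ..., wp_n). *)
Definition wp e C (k : nat) : nat := tau e (JC e C k).2.

Definition ordered e C : bool := [forall k : 'I_n, wp e C k == n - k]%N.

Definition LPLo e : {set {set Zqn q n}} := [set C in LPL e | ordered e C].

End MaximumMetric.

Definition maximal_pair (n e q : nat) : Prop :=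
  #|LPLo q n e| = ((2 * e + 1) ^ 'C(n, 2))%N.

Definition nabla n (d : int) : set 'M[int]_n :=
  (fun M => (forall i j : 'I_n, (j < i)%N -> M i j = 0) /\
            (forall i : 'I_n, M i i = d)).

Definition nabla_red n (e : nat) : set 'M[int]_n :=
  (fun M => nabla (2 * e + 1)%N%:Z M /\
            (forall i j : 'I_n, (i < j)%N -> `|M i j| <= e%:Z)).

Definition zspan n (M : 'M[int]_n) : set 'rV[int]_n :=
  inIntSpan [tuple row i M | i < n].

Definition qZn q n : set 'rV[int]_n :=
  range (fun v : 'rV[int]_n => v *+ q).

(* The image of span(M) under the reduction Z^n -> Z_q^n; it is the quotient
   span(M)/qZ^n as soon as qZ^n is contained in span(M). *)
Definition psi q n (M : 'M[int]_n) : {set Zqn q n} :=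
  [set x : Zqn q n |
     `[< exists2 v : 'rV[int]_n, zspan M v & map_mx intr v = x >]].

(* Main.v *)
Require Import Defs.
From mathcomp Require Import all_boot all_order all_algebra all_fingroup.
From mathcomp Require Import boolp classical_sets functions.
From mathcomp Require Import zify.
Import Order.TTheory GRing.Theory Num.Theory.

Local Open Scope ring_scope.

(** Write d = 2e+1.  The map psi goes between two finite sets of the same
    size: a reduced matrix has 'C(n, 2) free entries, each with d possible
    values, and maximality of (e, q) says that there are d ^ 'C(n, 2) ordered
    codes.  A map from the reduced matrices to codes whose image contains all
    ordered codes is therefore automatically injective and takes no other
    value, so it suffices to reach every ordered code C
    ([ordered_lattice]).

    Let L be the lattice of integer vectors whose reduction modulo q is in C.
    Orderedness says that for each coordinate i the section of C by the
    coordinates after i is of type i; as 0 lies in that section, this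
    provides a codeword which vanishes before i, equals d at i and is of size
    at most e after i ([ordered_row]).  Integer representatives of these
    codewords are the rows of a reduced matrix M with span M contained in L.

    Conversely, the cubes of side d centred at span M cover the integer
    vectors, because M is triangular with diagonal d ([zspan_reduce]).  Hence
    any v in L is within distance e of some w in span M, and v - w reduces to
    a codeword of size at most e.  The balls around this codeword and around
    0 meet, so the codeword is 0 ([perfect_eq0]), and then v = w because
    e < q.  Thus L = span M, which gives C = psi M.

    Once psi is a bijection, every reduced M is the matrix produced from the
    code psi M, so span M is the whole preimage lattice of that code; in
    particular it contains q Z^n. *)

(** * Integer representatives of residues *)

Lemma intr_Zq_eq0 {q : nat} (z : int) :
  (1 < q)%N -> z%:~R = 0 :> 'Z_q -> `|z| < q%:Z -> z = 0.
Proof.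
move=> q1.
have natr0 (m : nat) : m%:R = 0 :> 'Z_q -> (m < q)%N -> m = 0%N.
  by move/(congr1 (@nat_of_ord _)); rewrite val_Zp_nat //= => h /modn_small <-.
case: (intP z) => [//|m|m] z0 zq.
  by have := natr0 m.+1 z0; lia.
by move/eqP: z0; rewrite rmorphN oppr_eq0 => /eqP /(natr0 m.+1); lia.
Qed.

Lemma labs_intr {q : nat} (e : nat) (z : int) :
  (1 < q)%N -> `|z| <= e%:Z -> (e < q)%N -> (labs (z%:~R : 'Z_q) <= e)%N.
Proof.
move=> q1 ze eq; rewrite /labs.
case: z ze => m ze.
  rewrite -[(Posz m)%:~R]/(m%:R : 'Z_q) val_Zp_nat // modn_small; lia.
have -> : (Negz m)%:~R = (q - m.+1)%:R :> 'Z_q.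
  rewrite natrB; last lia.
  by rewrite pchar_Zp // sub0r.
rewrite val_Zp_nat // modn_small; lia.
Qed.

Lemma labs_lift {q : nat} (e : nat) (a : 'Z_q) :
  (1 < q)%N -> (labs a <= e)%N -> exists2 z : int, z%:~R = a & `|z| <= e%:Z.
Proof.
move=> q1; have := ltn_ord a; rewrite {2}Zp_cast // => aq.
rewrite /labs; case: (leqP a (q - a)) => h ae.
  by exists a%:Z; [rewrite -[LHS]/(a%:R) natr_Zp | lia].
exists (a%:Z - q%:Z); last by lia.
rewrite rmorphB /= -[X in X - _]/(a%:R) -[X in _ - X]/(q%:R).
by rewrite natr_Zp pchar_Zp // subr0.
Qed.

(** * Lattices spanned by triangular matrices *)

Lemma zspanP {n : nat} (M : 'M[int]_n) (v : 'rV[int]_n) :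
  zspan M v <-> exists u : 'rV[int]_n, v = u *m M.
Proof.
split=> [[a ->]|[u ->]].
  exists (\row_i a i); rewrite mulmx_sum_row; apply: eq_bigr => i _.
  by rewrite -tnth_nth tnth_mktuple mxE -[X in X *: _]intz scaler_int.
exists [ffun i => u 0 i]; rewrite mulmx_sum_row; apply: eq_bigr => i _.
by rewrite -tnth_nth tnth_mktuple ffunE -[X in X *: _]intz scaler_int.
Qed.

(** Rounding x / (2e+1) to a nearest integer: the intervals of radius e around
    the multiples of 2e+1 cover the integers. *)
Lemma round_div (e : nat) (x : int) :
  exists c : int, `|x - c * (2 * e + 1)%N%:Z| <= e%:Z.
Proof.
have d_gt0 : 0 < (2 * e + 1)%N%:Z by lia.
(* shifting by e turns a remainder in [0, 2e] into one in [-e, e] *)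
exists (divz (x + e%:Z) (2 * e + 1)%N%:Z).
have xE := divz_eq (x + e%:Z) (2 * e + 1)%N%:Z.
have r0 := modz_ge0 (x + e%:Z) (lt0r_neq0 d_gt0).
have rd := ltz_pmod (x + e%:Z) d_gt0.
by rewrite ler_norml; apply/andP; split; lia.
Qed.

(** Size reduction: row k changes no coordinate before k, so coordinates can be
    brought into the cube of radius e from left to right. *)
Lemma zspan_reduce {n e : nat} {M : 'M[int]_n} (v : 'rV[int]_n) :
  nabla (2 * e + 1)%N%:Z M ->
  exists2 w, zspan M w & forall i, `|v 0 i - w 0 i| <= e%:Z.
Proof.
case=> Mtrig Mdiag.
suff /(_ n (leqnn n))[w Mw wP] : forall k, (k <= n)%N ->
    exists2 w, zspan M w &
      forall i : 'I_n, (i < k)%N -> `|v 0 i - w 0 i| <= e%:Z.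
  by exists w => // i; apply: wP.
elim=> [|k IHk] kn.
  by exists 0 => //; apply/zspanP; exists 0; rewrite mul0mx.
have [w /zspanP[u wE] wP] := IHk (ltnW kn).
pose k0 := Ordinal kn.
have [c cP] := round_div e (v 0 k0 - w 0 k0).
exists (w + c *: row k0 M).
  apply/zspanP; exists (u + c *: delta_mx 0 k0).
  by rewrite mulmxDl -scalemxAl -rowE wE.
move=> i; rewrite ltnS leq_eqVlt !mxE => /orP[/eqP ik|ik].
  have -> : i = k0 by apply: val_inj.
  by rewrite Mdiag opprD addrA.
by rewrite Mtrig // mulr0 addr0; apply: wP.
Qed.

(** * The lattice of an ordered code *)

Lemma subgroup_intr {q n : nat} {C : {set Zqn q n}} (v : 'rV[int]_n)
    (M : 'M[int]_n) :
  group_set C -> (forall i, map_mx intr (row i M) \in C) ->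
  zspan M v -> map_mx intr v \in C.
Proof.
move=> gC MC /zspanP[u ->]; pose G := Group gC.
rewrite mulmx_sum_row raddf_sum.
apply: (big_ind (fun x => x \in G)) => [|x y|i _]; first exact: group1.
  exact: groupM.
rewrite -[u 0 i]intz scaler_int.
case: (u 0 i) => m; first by rewrite raddfMn; apply: (@groupX _ G) (MC i).
by rewrite raddfN raddfMn; apply: groupVr; apply: (@groupX _ G) (MC i).
Qed.

(** The origin lies both in the ball around 0 and in the one around x. *)
Lemma perfect_eq0 {q n e : nat} {C : {set Zqn q n}} (x : Zqn q n) :
  perfect e C -> 0 \in C -> x \in C ->
  (forall i, leq (labs (x 0 i)) e) -> x = 0.
Proof.
case/andP=> _ /forall_inP dis C0 Cx xe.
apply: contraTeq isT => x0.
have /implyP/(_ x0) := forall_inP (dis x Cx) 0 C0.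
have in_x : 0 \in ball x e.
  by rewrite inE; apply/bigmax_leqP=> i _; rewrite mxE subr0.
have in_0 : 0 \in ball (0 : Zqn q n) e.
  by rewrite inE; apply/bigmax_leqP=> i _; rewrite subrr /labs min0n.
by move/disjointFr/(_ in_x); rewrite in_0.
Qed.

Lemma tau_type {q n e : nat} {D : {set Zqn q n}} (i : 'I_n) :
  tau e D = i.+1 -> of_type e D i.
Proof.
move=> tD.
suff [t0|[j Dj]] : tau e D = 0%N \/ exists2 j, of_type e D j & tau e D = j.+1.
- by rewrite t0 in tD.
- by rewrite tD => -[/val_inj ->].
apply: (big_ind (fun m => m = 0%N \/ exists2 j, of_type e D j & m = j.+1)).
- by left.
- by move=> x y Px Py; rewrite /maxn; case: ifP.
- by move=> j Dj; right; exists j.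
Qed.

(** Coordinates are collected from the last one downwards: at step k the new
    one, n - k in one-based numbering, is the predecessor of the least
    coordinate collected so far. *)
Lemma ordered_JC1 {q n e : nat} {C : {set Zqn q n}} (k : nat) :
  ordered e C -> (k <= n)%N ->
  (JC e C k).1 = [set j : 'I_n | n - k <= j]%N.
Proof.
move=> /forallP oC; elim: k => [|k IHk] kn.
  by apply/setP=> j; rewrite !inE subn0 leqNgt ltn_ord.
apply/setP=> j; rewrite /= (IHk (ltnW kn)) !inE.
have /eqP := oC (Ordinal kn); rewrite /wp /= => ->; lia.
Qed.

(** The sign comes from measuring the distance from a point of H_J, whose
    coordinates in J are 0, to the codeword c. *)
Lemma JC_sub {q n e k : nat} {C : {set Zqn q n}} (x : Zqn q n) :
  x \in (JC e C k).2 ->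
  exists2 c, c \in C & forall i,
    if i \in (JC e C k).1 then is_true (leq (labs (- c 0 i)) e)
    else c 0 i = x 0 i.
Proof.
case: k => [|k] /=; first by move=> Cx; exists x => // i; rewrite inE.
move: (_ :|: _) => J /finset.imsetP[c]; rewrite inE => /andP[/bigcupP[h]].
rewrite !inE => /forall_inP hJ /bigmax_leqP hc Cc ->; exists c => // i.
by case: ifP => iJ; [have := hc i isT; rewrite (eqP (hJ i iJ)) sub0r
                    | rewrite mxE iJ].
Qed.

Lemma JC_0 {q n e k : nat} {C : {set Zqn q n}} : 0 \in C -> 0 \in (JC e C k).2.
Proof.
move=> C0; case: k => [//|k] /=; move: (_ :|: _) => J.
apply/finset.imsetP; exists 0; last by apply/rowP=> i; rewrite !mxE if_same.
rewrite inE C0 andbT; apply/bigcupP; exists 0; rewrite !inE.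
  by apply/forall_inP=> i _; rewrite mxE.
by apply/bigmax_leqP=> i _; rewrite subrr /labs min0n.
Qed.

(** The section of C by the coordinates after i is of type i and contains 0,
    hence contains d e_i; undoing the projection restores small entries
    after i. *)
Lemma ordered_row {q n e : nat} {C : {set Zqn q n}} (i : 'I_n) :
  (1 < q)%N -> 0 \in C -> ordered e C ->
  exists r : 'rV[int]_n,
    [/\ map_mx intr r \in C, forall j : 'I_n, (j < i)%N -> r 0 j = 0,
        r 0 i = (2 * e + 1)%N%:Z &
        forall j : 'I_n, (i < j)%N -> `|r 0 j| <= e%:Z].
Proof.
move=> q1 C0 oC; have ltin := ltn_ord i.
have kP : (n - i.+1 < n)%N by lia.
have JE := ordered_JC1 (n - i.+1) oC (ltnW kP).
have tE : tau e (JC e C (n - i.+1)).2 = i.+1.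
  by have /forallP/(_ (Ordinal kP))/eqP := oC; rewrite /wp /= => ->; lia.
have /forall_inP/(_ 0 (JC_0 C0)) := tau_type i tE.
move=> /JC_sub[c Cc cP].
have /fin_all_exists[f fP] (j : 'I_n) : exists z : int,
    [/\ z%:~R = c 0 j, (j < i)%N -> z = 0, j = i -> z = (2 * e + 1)%N%:Z &
        (i < j)%N -> `|z| <= e%:Z].
  have := cP j; rewrite JE inE add0r mulmxnE mxE eqxx /=.
  have -> : (n - (n - i.+1) <= j)%N = (i < j)%N by lia.
  case: (ltngtP i j) => [ij|ij|/val_inj <-].
  - move=> /(labs_lift _ _ q1)[z zE ze]; exists (- z).
    split=> [|//|ji|_]; [by rewrite mulrNz zE opprK| |by rewrite normrN].
    by rewrite ji ltnn in ij.
  - have /negPf-> : j != i by rewrite -val_eqE ltn_eqF.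
    rewrite mul0rn => ->; exists 0; split=> // ji.
    by rewrite ji ltnn in ij.
  - by rewrite eqxx => ->; exists (2 * e + 1)%N%:Z; split.
exists (\row_j f j); split.
- suff -> : map_mx intr (\row_j f j) = c by [].
  by apply/rowP=> j; rewrite !mxE; case: (fP j).
- by move=> j ji; rewrite mxE; case: (fP j) => _ /(_ ji).
- by rewrite mxE; case: (fP i) => _ _ ->.
- by move=> j ij; rewrite mxE; case: (fP j) => _ _ _ /(_ ij).
Qed.

(** The rows of M come from [ordered_row].  An element of the lattice of C is
    congruent modulo span M to a small one, which is 0 by disjointness of the
    balls. *)
Lemma ordered_lattice {q n e : nat} {C : {set Zqn q n}} :
  (1 < q)%N -> (e < q)%N -> C \in LPLo q n e ->
  exists2 M : 'M[int]_n, nabla_red e M &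
    forall v, zspan M v <-> map_mx intr v \in C.
Proof.
move=> q1 eq; rewrite !inE => /andP[/and3P[gC _ pC] oC].
pose G := Group gC; have C0 : 0 \in C by exact: (group1 G).
have /fin_all_exists[r rP] := fun i => ordered_row i q1 C0 oC.
pose M := \matrix_i r i.
have MC i : map_mx intr (row i M) \in C by rewrite rowK; case: (rP i).
have Mnabla : nabla (2 * e + 1)%N%:Z M.
  by split=> [i j ji|i]; rewrite mxE; case: (rP i) => // _ /(_ j ji).
exists M.
  by split=> // i j ij; rewrite mxE; case: (rP i) => _ _ _; apply.
move=> v; split=> [|Cv]; first exact: subgroup_intr.
have [w Mw vw] := zspan_reduce v Mnabla.
suff -> : v = w by [].
have Cw := subgroup_intr _ _ gC MC Mw.
have /rowP vw0 : map_mx intr (v - w) = 0 :> Zqn q n.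
  apply: (perfect_eq0 (e := e) _ pC C0).
    by rewrite raddfB; apply: (groupM (G := G)); rewrite // (groupV G).
  by move=> i; rewrite !mxE; apply: labs_intr => //; lia.
apply/rowP=> i; apply/eqP; rewrite -subr_eq0; apply/eqP.
apply: (intr_Zq_eq0 _ q1); first by have := vw0 i; rewrite !mxE.
by have := vw i; lia.
Qed.

Lemma psi_lattice {q n : nat} {C : {set Zqn q n}} {M : 'M[int]_n} :
  (forall v, zspan M v <-> map_mx intr v \in C) -> psi q M = C.
Proof.
move=> MC; apply/setP=> x; rewrite inE; apply/asboolP/idP.
  by case=> v /MC Cv <-.
have xE : map_mx intr (\row_i (x 0 i : nat)%:Z) = x.
  by apply/rowP=> i; rewrite !mxE -[LHS]/(_%:R) natr_Zp.
by move=> Cx; exists (\row_i (x 0 i : nat)%:Z) => //; apply/MC; rewrite xE.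
Qed.

(** * Counting reduced matrices *)

Local Notation upper_entries n := {p : 'I_n * 'I_n | (p.1 < p.2)%N}.

Lemma card_upper_entries (n : nat) : #|{: upper_entries n}| = 'C(n, 2).
Proof.
rewrite card_sig -sum1_card -bin2_sum big_mkord.
rewrite (eq_bigl (fun p : 'I_n * 'I_n => true && (p.1 < p.2)%N)) //.
rewrite -(pair_big_dep xpredT (fun i j : 'I_n => (i < j)%N) (fun _ _ => 1%N)) /=.
(* column j contains j entries above the diagonal *)
rewrite (exchange_big_dep xpredT) //=; apply: eq_bigr => j _.
by rewrite -(big_ord_widen n (fun=> 1%N) (ltnW (ltn_ord j))) sum1_card card_ord.
Qed.

(** Entries in [-e, e] are encoded by their shift by e, an ordinal. *)
Definition red_mx {n e : nat} (f : {ffun upper_entries n -> 'I_(2 * e + 1)}) :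
    'M[int]_n :=
  \matrix_(i, j) if i == j then (2 * e + 1)%N%:Z else
    if insub (i, j) is Some p then (f p)%:Z - e%:Z else 0.

Lemma red_mx_nabla {n e : nat} (f : {ffun upper_entries n -> 'I_(2 * e + 1)}) :
  nabla_red e (red_mx f).
Proof.
split; first split=> [i j ji|i]; rewrite ?mxE ?eqxx //.
  rewrite insubN /=; last by rewrite -leqNgt ltnW.
  by case: eqP ji => [->|//]; rewrite ltnn.
move=> i j ij; rewrite mxE insubT /=.
case: eqP ij => [->|_ ij]; first by rewrite ltnn.
by have := ltn_ord (f (Sub (i, j) ij)); lia.
Qed.

Lemma red_mx_onto {n e : nat} (M : 'M[int]_n) :
  nabla_red e M ->
  exists f : {ffun upper_entries n -> 'I_(2 * e + 1)}, red_mx f = M.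
Proof.
case=> -[Mtrig Mdiag] Mred.
have dE : (2 * e + 1 = (2 * e).+1)%N by rewrite addn1.
(* cast because inord needs a bound that is syntactically a successor *)
exists [ffun p : upper_entries n => cast_ord (esym dE)
          (inord (absz (M (val p).1 (val p).2 + e%:Z)%R))].
apply/matrixP=> i j; rewrite mxE; case: eqP => [->|/eqP ij].
  by rewrite Mdiag.
case: insubP => [p /= pP pE|/=].
  rewrite ffunE /= pE /=; have := Mred i j pP.
  by move=> h; rewrite inordK; lia.
rewrite -leqNgt leq_eqVlt => /orP[/eqP/val_inj ji|ji]; last by rewrite Mtrig.
by rewrite ji eqxx in ij.
Qed.

(** * The parametrization *)

Theorem theorem5p27 (n e t q : nat) (hn : (1 <= n)%N) (ht : (1 < t)%N)
    (hq : q = ((2 * e + 1) * t)%N) (hmax : maximal_pair n e q) :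
  (forall M : 'M[int]_n, nabla_red e M -> (@qZn q n `<=` zspan M)%classic) /\
  set_bij (@nabla_red n e) [set` @LPLo q n e]%classic (@psi q n).
Proof.
have eq : (e < q)%N by nia.
have q1 : (1 < q)%N by nia.
pose T := {ffun upper_entries n -> 'I_(2 * e + 1)}.
pose F (f : T) := psi q (red_mx f).
have onto : LPLo q n e \subset [set F f | f : T].
  apply/fintype.subsetP=> C /(ordered_lattice q1 eq)[M Mred MC].
  have [f fM] := red_mx_onto M Mred.
  by apply/finset.imsetP; exists f => //; rewrite /F fM (psi_lattice MC).
have cardT : #|T| = #|LPLo q n e|.
  by rewrite hmax card_ffun card_ord card_upper_entries.
have Fcard : #|[set F f | f : T]| = #|T|.
  apply/eqP; rewrite eqn_leq leq_imset_card cardT; exact: subset_leq_card.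
(* a surjection between finite sets of the same size *)
have Finj : injective F.
  by move=> f g; apply: (imset_injP (introT eqP Fcard)).
have FE : [set F f | f : T] = LPLo q n e.
  by apply/esym/eqP; rewrite eqEcard onto Fcard cardT leqnn.
have psiLPLo (M : 'M[int]_n) : nabla_red e M -> psi q M \in LPLo q n e.
  by move=> /red_mx_onto[f <-]; rewrite -FE; apply: imset_f.
have psi_inj (M N : 'M[int]_n) :
    nabla_red e M -> nabla_red e N -> psi q M = psi q N -> M = N.
  by move=> /red_mx_onto[f <-] /red_mx_onto[g <-] /Finj->.
split.
  move=> M Mred _ [v _ <-].
  (* injectivity identifies M with the matrix whose span is the full preimage
     of psi q M *)
  have [N Nred NC] := ordered_lattice q1 eq (psiLPLo M Mred).
  rewrite (psi_inj M N) ?(psi_lattice NC) //; apply/NC.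
  suff -> : map_mx intr (v *+ q) = 0 :> Zqn q n.
    move: (psi q M) (psiLPLo M Mred) => C.
    rewrite !inE => /andP[/and3P[gC _ _] _].
    exact: (group1 (Group gC)).
  by apply/rowP=> i; rewrite raddfMn mulmxnE !mxE -mulr_natr pchar_Zp // mulr0.
split=> [M|M N|C /=].
- exact: psiLPLo.
- by move=> /set_mem Mred /set_mem Nred; apply: psi_inj.
- move=> /(ordered_lattice q1 eq)[M Mred MC].
  by exists M => //; apply: psi_lattice.
Qed.
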